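(* Let $G$ be a connected $k$-regular multigraph of order $n$ (loops and multiple edges allowed) with only $3$ distinct eigenvalues. If $k \neq 2,3,7,57$, then $$n \leq k^2-k+1.$$
   Context: A multigraph $G=(V,E)$ is finite and undirected, and may have multiple edges and loops. For $u,v\in V$, $m(u,v)$ is the number of edges between $u$ and $v$ if $u\neq v$, and the number of loops on $u$ if $u=v$. The order of $G$ is $n=|V|$. The adjacency matrix of $G$ is the symmetric matrix $A$ indexed by $V$ with $(u,v)$-entry $m(u,v)$ (so each loop contributes $1$ to the diagonal). $G$ is $k$-regular if $\sum_{v\in V} m(u,v)=k$ for each $u\in V$ (so each loop contributes $1$ to the degree). The eigenvalues of $G$ are the eigenvalues of $A$; ''only 3 distinct eigenvalues'' means that $A$ has exactly three distinct eigenvalues. *)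

(* Defs.v *)
From mathcomp Require Import all_boot all_order all_algebra all_field.

Set Implicit Arguments.
Unset Strict Implicit.
Unset Printing Implicit Defensive.

Import GRing.Theory.

(* An edge carries its set of endpoints: two vertices for an ordinary edge,
   one vertex for a loop.  Distinct edges may have the same endpoints. *)
Record multigraph := Multigraph {
  vertex : finType;
  edge : finType;
  ends : edge -> {set vertex};
  card_ends : forall e : edge, 0 < #|ends e| <= 2
}.

Definition order_of (G : multigraph) : nat := #|vertex G|.

(* [set u; u] = [set u], so mult u u is the number of loops on u. *)
Definition mult (G : multigraph) (u v : vertex G) : nat :=
  #|[set e : edge G | ends e == [set u; v]]|.

Definition regular (G : multigraph) (k : nat) : Prop :=
  forall u : vertex G, \sum_(v : vertex G) mult u v = k.

Definition adjacent (G : multigraph) : rel (vertex G) :=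
  fun u v => 0 < mult u v.

Definition connected (G : multigraph) : Prop :=
  0 < order_of G /\ forall u v : vertex G, connect (@adjacent G) u v.

(* Rows and columns are indexed by V through its canonical enumeration.
   The entries are integers, so no eigenvalue is lost by working in algC. *)
Definition adjmx (G : multigraph) : 'M[algC]_(order_of G) :=
  (\matrix_(i, j) (mult (enum_val i) (enum_val j))%:R)%R.

Definition num_eigenvalues (G : multigraph) (d : nat) : Prop :=
  exists s : seq algC,
    [/\ uniq s, size s = d & forall a : algC, eigenvalue (adjmx G) a <-> a \in s].

(* Main.v *)
(* Write A for the adjacency matrix.  With eigenvalues k, x, y, the spectral
   theorem and the simplicity of k give (A - x)(A - y) = c J with c <> 0, so two
   distinct non-adjacent vertices are joined by exactly c walks of length 2.
   Of the k^2 walks of length 2 from u at least k return to u.  If u reaches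
   every other vertex by a 2-walk, the other k^2 - k walks bound n - 1.  If c >= 2,
   twice the number of non-neighbours is at most k^2 - k, which suffices.
   Otherwise c = 1 and adjacent vertices without a common 2-walk force G to be
   simple with x + y = -1 and n = k^2 + 1: a Moore graph, excluded by the
   Hoffman-Singleton argument. *)
Require Import Defs.
From mathcomp Require Import all_boot all_order all_algebra all_field.
From mathcomp Require Import zify ring.

Set Implicit Arguments.
Unset Strict Implicit.
Unset Printing Implicit Defensive.

Import Order.TTheory GRing.Theory Num.Theory.

(** * Spectral facts: traces of idempotents, annihilating polynomials, multiplicities *)

Section LinearAlgebra.

Local Open Scope ring_scope.

(** A full-rank factorization [P = C R] turns [P P = P] into [R C = 1], and [C R] and [R C] have the
    same trace. *)
Lemma mxtrace_idempotent (F : fieldType) n (P : 'M[F]_n) :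
  P *m P = P -> \tr P = (\rank P)%:R.
Proof.
have := mulmx_base P.
have /row_freeP[R'] := row_base_free P; have /row_fullP[C'] := col_base_full P.
move: (\rank P) (col_base P) (row_base P) C' R' => r C R C' R' CC' RR' <- PP.
suff RC1 : R *m C = 1%:M by rewrite mxtrace_mulC RC1 mxtrace1.
have := congr1 (fun M => C' *m M *m R') PP.
by rewrite !mulmxA CC' !mul1mx -!mulmxA RR' mulmx1.
Qed.

Lemma spectral_diag_eigenvalue (C : numClosedFieldType) n (A : 'M[C]_n) i :
  A \is normalmx -> eigenvalue A (spectral_diag A 0 i).
Proof.
move=> /orthomx_spectralP AE; set P := spectralmx A in AE *.
have Pu : P \in unitmx := spectral_unit A.
have PA : P *m A = diag_mx (spectral_diag A) *m P.
  by rewrite [X in _ *m X = _]AE !mulmxA mulmxV // mul1mx.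
apply/eigenvalueP; exists (row i P).
  by rewrite -row_mul PA row_mul row_diag_mx -scalemxAl -rowE.
apply: contraTneq Pu => Pi0; rewrite -row_free_unit.
apply/negP => /(@row_free_inj _ 1) /(_ (delta_mx 0 i) 0).
rewrite /= -rowE mul0mx Pi0 => /(_ erefl) /matrixP /(_ 0 i) /eqP.
by rewrite !mxE !eqxx oner_eq0.
Qed.

(** In the spectral basis the product is diagonal, and each diagonal entry has a factor that
    vanishes. *)
Lemma normalmx_annihilated (C : numClosedFieldType) n (A : 'M[C]_n) x y z :
    A \is normalmx -> (forall a, eigenvalue A a -> a \in [:: x; y; z]) ->
  (A - x%:M) *m (A - y%:M) *m (A - z%:M) = 0.
Proof.
move=> nA eigA; have /orthomx_spectralP AE := nA.
set P := spectralmx A in AE; set d := spectral_diag A in AE.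
have Pu : P \in unitmx := spectral_unit A.
have shift a : A - a%:M = invmx P *m diag_mx (d - const_mx a) *m P.
  rewrite raddfB /= diag_const_mx mulmxBr mulmxBl -AE mul_mx_scalar -scalemxAl.
  by rewrite mulVmx // scalemx1.
rewrite !shift !mulmxA !(mulmxKV Pu, mulmxK Pu).
rewrite -(mulmxA _ _ (diag_mx (d - const_mx y))) mulmx_diag.
rewrite -(mulmxA _ _ (diag_mx (d - const_mx z))) mulmx_diag.
set D := diag_mx _; suff -> : D = 0 by rewrite mulmx0 mul0mx.
rewrite /D -[RHS](raddf0 (@diag_mx C n)); congr diag_mx; apply/rowP => i.
rewrite !mxE; have := eigA _ (spectral_diag_eigenvalue i nA).
rewrite !inE -/d => /or3P[] /eqP->; rewrite subrr ?(mul0r, mulr0) //.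
Qed.

Lemma sum_delta (R : pzSemiRingType) (T : finType) (x : T) :
  \sum_y (x == y)%:R = 1 :> R.
Proof.
rewrite (bigD1 x) //= eqxx big1 ?addr0 // => y.
by rewrite eq_sym => /negPf->.
Qed.

(* [A - y - t J] is [x - y] times the projector onto the [x]-eigenspace of [A]. *)
Lemma mxtrace_three_eigenvalues (F : numFieldType) n (A : 'M[F]_n) (d x y c : F) :
    (0 < n)%N -> x != y ->
    A *m A = (x + y) *: A - (x * y)%:M + c *: const_mx 1 ->
    A *m const_mx 1 = d *: (const_mx 1 : 'M_n) ->
    (const_mx 1 : 'M_n) *m A = d *: const_mx 1 ->
    c * n%:R = (d - x) * (d - y) ->
  exists f : nat, \tr A - n%:R * y - (d - y) = f%:R * (x - y).
Proof.
move=> n_gt0 xy AA AJ JA cn; set J : 'M[F]_n := const_mx 1 in AA AJ JA *.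
have n_neq0 : n%:R != 0 :> F by rewrite pnatr_eq0 -lt0n.
have xy0 : x - y != 0 by rewrite subr_eq0.
have JJ : J *m J = n%:R *: J.
  apply/matrixP => i j; rewrite !mxE.
  under eq_bigr do rewrite !mxE mulr1.
  by rewrite sumr_const card_ord mulr1.
(* This [t] makes [B] kill the all-ones vector, on which [A - y] acts as [d - y] and [J] as [n]. *)
pose t := (d - y) / n%:R; pose B := A - y%:M - t *: J.
have BB : B *m B = (x - y) *: B.
  rewrite /B !mulmxBl !mulmxBr -!scalemxAl -!scalemxAr AA AJ JA JJ.
  rewrite !mul_mx_scalar !mul_scalar_mx scale_scalar_mx.
  have tn : t * n%:R = d - y by rewrite /t divfK.
  have tc : c = t * (d - x) by apply: (mulIf n_neq0); rewrite cn mulrAC tn mulrC.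
  have yE : y = d - t * n%:R by rewrite tn; ring.
  rewrite tc; move: t yE {B tn tc} => t yE; apply/matrixP => i j.
  by rewrite !mxE yE; ring.
have := @mxtrace_idempotent _ n ((x - y)^-1 *: B).
rewrite -scalemxAl -scalemxAr BB (scalerA _ _ B) mulVf // scale1r => /(_ erefl).
rewrite mxtraceZ => /(congr1 ( *%R (x - y))); rewrite mulVKf // => trB.
(* The witness is the rank of the projector, so [f] is the multiplicity of [x]. *)
exists (\rank ((x - y)^-1 *: B)).
rewrite [RHS]mulrC -{}trB /B !raddfB /= mxtrace_scalar mxtraceZ.
have -> : \tr J = n%:R.
  by rewrite /mxtrace; under eq_bigr do rewrite mxE; rewrite sumr_const card_ord.
by rewrite /t divfK //; ring.
Qed.

End LinearAlgebra.

(* [4k - 3] divides [(4k)^2 (4k - 8)^2], which is [15^2] modulo [4k - 3]. *)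
Lemma moore_arith (k : nat) (w : int) :
    (w ^+ 2 * (4 * k%:Z - 3) = (k%:Z ^+ 2 - 2 * k%:Z) ^+ 2)%R -> 1 < k ->
  k \in [:: 2; 3; 7; 57].
Proof.
move=> wE k_gt1; have N225 : (4 * k - 3) %| 225.
  pose N : int := (4 * k%:Z - 3)%R.
  have : (N %| 225)%Z.
    (* Since [16 (k^2 - 2k) = N^2 - 2N - 15], the hypothesis reads [256 w^2 N = (N^2 - 2N - 15)^2];
       the witness collects the multiples of [N]. *)
    apply/dvdzP; exists (256 * w ^+ 2 - (N - 2) * (N ^+ 2 - 2 * N - 30))%R.
    have : (256 * (w ^+ 2 * N) = (N ^+ 2 - 2 * N - 15) ^+ 2)%R.
      by rewrite wE /N; ring.
    by move=> NE; rewrite mulrBl -mulrA NE; ring.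
  by rewrite dvdzE /=; congr (_ %| _); rewrite /N; lia.
have k_lt58 : k < 58 by have := @dvdn_leq _ 225 isT N225; lia.
have : all (fun j => ((4 * j - 3) %| 225) ==> (j \in [:: 1; 2; 3; 7; 12; 57]))
           (iota 0 58) by [].
move=> /allP/(_ k); rewrite mem_iota => /(_ k_lt58) /implyP /(_ N225).
rewrite !inE => /or4P[/eqP k1|->|->|/or3P[->|/eqP k12|->]]; rewrite ?orbT //.
  by rewrite k1 in k_gt1.
(* The divisor 45 gives [k = 12], where [w^2 = 120^2 / 45 = 320] lies strictly between [17^2] and
   [18^2]. *)
have w320 : (w ^+ 2 = 320)%R by move: wE; rewrite k12; lia.
have : `|w|%N ^ 2 = 320 by apply/eqP; rewrite -eqz_nat -abszX w320.
by move=> w2; have [] := leqP `|w|%N 17; rewrite -leq_sqr w2.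
Qed.

(** * Counting 2-walks and bounding the order *)

Section Multigraph.

Variable G : multigraph.
Implicit Types u v w : vertex G.

Definition walks2 u v : nat := \sum_w mult u w * mult w v.

Lemma mult_sym u v : mult u v = mult v u.
Proof. by rewrite /mult setUC. Qed.

Lemma walks2_gt0 u w v : adjacent u w -> adjacent w v -> 0 < walks2 u v.
Proof.
move=> uw wv; rewrite /walks2 (bigD1 w) //= addn_gt0 muln_gt0.
by rewrite [0 < mult u w]uw [0 < mult w v]wv.
Qed.

Lemma sum_walks2 k u : regular G k -> \sum_v walks2 u v = k ^ 2.
Proof.
move=> reg; rewrite /walks2 exchange_big /= -mulnn -{1}(reg u) big_distrl /=.
by apply: eq_bigr => w _; rewrite -big_distrr /= reg.
Qed.

Lemma leq_degree_walks2 k u : regular G k -> k <= walks2 u u.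
Proof.
move=> reg; rewrite -(reg u); apply: leq_sum => w _.
by rewrite (mult_sym w); case: (mult u w) => // m; rewrite leq_pmulr.
Qed.

Lemma sum_walks2_neq k u :
  regular G k -> walks2 u u + \sum_(v | v != u) walks2 u v = k ^ 2.
Proof. by move=> reg; rewrite -(sum_walks2 u reg) [RHS](bigD1 u). Qed.

Lemma order_le_walks2 k u :
    regular G k -> (forall v, v != u -> 0 < walks2 u v) ->
  order_of G <= k ^ 2 - k + 1.
Proof.
move=> reg W_gt0; have := sum_walks2_neq u reg; have := leq_degree_walks2 u reg.
have : #|predC1 u| <= \sum_(v | v != u) walks2 u v.
  by rewrite -sum1_card; apply: leq_sum.
rewrite /order_of; have := cardC1 u; lia.
Qed.

Lemma order_le_complete k u :
    regular G k -> (forall v, v != u -> adjacent u v) -> order_of G <= k + 1.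
Proof.
move=> reg adj; have : #|predC1 u| <= k.
  rewrite -(reg u) -sum1_card [leqRHS](bigD1 u) //=.
  by apply: leq_trans (leq_addl _ _); apply: leq_sum.
by rewrite /order_of cardC1; lia.
Qed.

Lemma order_le_two_walks k u :
    regular G k ->
    (forall v, v != u -> ~~ adjacent u v -> 1 < walks2 u v) ->
  2 * order_of G <= k ^ 2 + k + 2.
Proof.
move=> reg W_gt1; have := sum_walks2_neq u reg; have := leq_degree_walks2 u reg.
(* The weight [2 * mult u v] covers the neighbours, which may have no 2-walk from [u]; in total it
   adds at most [2k]. *)
have : 2 * #|predC1 u| <= \sum_(v | v != u) (walks2 u v + 2 * mult u v).
  rewrite -sum1_card big_distrr /=; apply: leq_sum => v vu.
  have := W_gt1 v vu; rewrite /adjacent; case: (mult u v) => [|m] //=.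
    by move/(_ isT); lia.
  by lia.
rewrite big_split /= -big_distrr /=.
have : \sum_(v | v != u) mult u v <= k.
  by rewrite -(reg u) [leqRHS](bigD1 u) ?leq_addl.
rewrite /order_of cardC1; set S := \sum_(v | v != u) walks2 u v.
set M := \sum_(v | v != u) mult u v; lia.
Qed.

(** * From the spectrum to a formula for 2-walks *)

Local Open Scope ring_scope.

Lemma sum_vertex_ord (V : nmodType) (F : vertex G -> V) :
  \sum_v F v = \sum_(i < order_of G) F (enum_val i).
Proof. exact: reindex (onW_bij _ (enum_val_bij _)). Qed.

(* The Laplacian form [\sum m(u,v) |f u - f v|^2] vanishes at a [k]-eigenvector. *)
Lemma eigenfunction_constant (C : numClosedFieldType) k (f : vertex G -> C) :
    regular G k -> connected G ->
    (forall u, \sum_v (mult u v)%:R * f v = k%:R * f u) ->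
  forall u v, f u = f v.
Proof.
move=> reg [_ conn] fE.
pose E u v := (mult u v)%:R * `|f u - f v| ^+ 2.
have E_ge0 u v : 0 <= E u v by rewrite mulr_ge0 ?ler0n ?exprn_ge0.
have regC u : \sum_v (mult u v)%:R = k%:R :> C by rewrite -natr_sum reg.
have fEc u : \sum_v (mult u v)%:R * (f v)^* = k%:R * (f u)^*.
  rewrite -[k%:R]conjC_nat -rmorphM -fE rmorph_sum; apply: eq_bigr => v _.
  by rewrite rmorphM /= conjC_nat.
have EE u v : E u v = (mult u v)%:R * (f u * (f u)^*)
    + (mult u v)%:R * (f v * (f v)^*)
    - f u * ((mult u v)%:R * (f v)^*) - (f u)^* * ((mult u v)%:R * f v).
  by rewrite /E normCK rmorphB /=; ring.
(* By regularity and symmetry the two square terms each sum to [k] times the squared norm of [f]; by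
   the eigenvector equation each cross term subtracts the same amount. *)
have E0 : \sum_u \sum_v E u v = 0.
  under eq_bigr => u _.
    under eq_bigr => v _ do rewrite EE.
    rewrite !big_split /= !sumrN -!big_distrr /= -big_distrl /= regC fE fEc.
    over.
  rewrite !big_split /= exchange_big /=.
  under [X in _ + X + _ + _]eq_bigr => v _.
    under eq_bigr => u _ do rewrite mult_sym.
    rewrite -big_distrl /= regC; over.
  rewrite -!big_split /=; apply: big1 => u _; ring.
have adj_eq u v : adjacent u v -> f u = f v.
  move=> uv; apply/eqP; rewrite -subr_eq0 -normr_eq0 -(sqrf_eq0 `|_|).
  have /(_ (fun u _ => sumr_ge0 _ (fun v _ => E_ge0 u v))) := psumr_eq0P _ E0.
  move=> /(_ u isT) /psumr_eq0P => /(_ (fun v _ => E_ge0 u v) v isT) /eqP.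
  by rewrite mulf_eq0 pnatr_eq0 -(negbK (mult u v == 0)%N) -lt0n [(0 < _)%N]uv.
move=> u v; have /connectP[p path_p ->] := conn u v.
elim: p u path_p => //= w p IHp u /andP[uw /IHp <-]; exact: adj_eq.
Qed.

Lemma walks2_sym u v : walks2 u v = walks2 v u.
Proof.
by apply: eq_bigr => w _; rewrite mulnC (mult_sym u) (mult_sym w).
Qed.

Lemma adjmx_normal : adjmx G \is normalmx.
Proof.
suff AE : map_mx Num.conj (adjmx G)^T = adjmx G by apply/normalmxP; rewrite AE.
by apply/matrixP => i j; rewrite !mxE conjC_nat mult_sym.
Qed.

Lemma adjmx_sqr i j :
  (adjmx G *m adjmx G) i j = (walks2 (enum_val i) (enum_val j))%:R.
Proof.
rewrite !mxE natr_sum sum_vertex_ord; apply: eq_bigr => l _.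
by rewrite !mxE -natrM.
Qed.

Lemma regular_eigenvalue k :
  (0 < order_of G)%N -> regular G k -> eigenvalue (adjmx G) k%:R.
Proof.
move=> n_gt0 reg; apply/eigenvalueP; exists (const_mx 1); last first.
  apply/eqP => /rowP/(_ (Ordinal n_gt0))/eqP.
  by rewrite !mxE oner_eq0.
apply/rowP => j; rewrite !mxE mulr1 -(reg (enum_val j)) natr_sum sum_vertex_ord.
by apply: eq_bigr => i _; rewrite !mxE mul1r mult_sym.
Qed.

Lemma num_eigenvalues_leq_order d : num_eigenvalues G d -> (d <= order_of G)%N.
Proof.
case=> s [s_uniq <- sE]; rewrite -ltnS -(size_char_poly (adjmx G)).
apply: max_poly_roots s_uniq; first exact: monic_neq0 (char_poly_monic _).
by apply/allP => a /sE; rewrite eigenvalue_root_char.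
Qed.

(** [A - k] annihilates the columns of [(A - x)(A - y)], so these are constant by connectedness;
    being symmetric, the product is a multiple [c] of [J]. *)
Lemma walks2_three_eigenvalues k :
    connected G -> regular G k -> num_eigenvalues G 3 ->
  exists x y c : algC, [/\ x != y, c != 0 & forall u v,
    (walks2 u v)%:R = (x + y) * (mult u v)%:R - x * y * (u == v)%:R + c].
Proof.
move=> conn reg [s [s_uniq s_size sE]]; have [n_gt0 _] := conn.
have /rot_to[i s' s'E] := (sE _).1 (regular_eigenvalue n_gt0 reg).
move: s_uniq s_size; rewrite -(rot_uniq i) -(size_rot i) s'E.
case: s' s'E => [|x [|y []]] //= s'E; rewrite !inE !andbT !negb_or.
move=> /andP[/andP[kx ky] xy] _.
have annA : (adjmx G - k%:R%:M) *m (adjmx G - x%:M) *m (adjmx G - y%:M) = 0.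
  apply: normalmx_annihilated adjmx_normal _ => a /sE.
  by rewrite -(mem_rot i) s'E.
pose g u v := (walks2 u v)%:R - (x + y) * (mult u v)%:R + x * y * (u == v)%:R.
have g_sym u v : g u v = g v u by rewrite /g walks2_sym mult_sym eq_sym.
have gE i1 j : ((adjmx G - x%:M) *m (adjmx G - y%:M)) i1 j
    = g (enum_val i1) (enum_val j).
  rewrite mulmxBl !mulmxBr -scalar_mxM mul_mx_scalar mul_scalar_mx.
  have -> (X Y Z T : 'M[algC]_(order_of G)) :
      (X - Y - (Z - T)) i1 j = X i1 j - Y i1 j - Z i1 j + T i1 j.
    by rewrite !mxE; ring.
  rewrite adjmx_sqr !mxE /g (inj_eq enum_val_inj) -mulr_natr; ring.
have g_eigen v u : \sum_w (mult u w)%:R * g w v = k%:R * g u v.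
  move: annA; rewrite -mulmxA mulmxBl mul_scalar_mx => /subr0_eq.
  move=> /matrixP/(_ (enum_rank u) (enum_rank v)).
  rewrite [LHS]mxE [RHS]mxE gE !enum_rankK => <-; rewrite sum_vertex_ord.
  by apply: eq_bigr => j _; rewrite gE !mxE !enum_rankK.
have g_const u u' v v' : g u v = g u' v'.
  rewrite (eigenfunction_constant reg conn (g_eigen v) u u') g_sym.
  by rewrite (eigenfunction_constant reg conn (g_eigen u') v v') g_sym.
pose u0 : vertex G := enum_val (Ordinal n_gt0).
exists x, y, (g u0 u0); split=> // [|u v]; last by rewrite (g_const _ u _ v) /g; ring.
(* If [c = 0], the row sum [(k - x)(k - y)] vanishes, against [k] being distinct from [x] and
   [y]. *)
apply: contraTneq kx => g0; rewrite negbK -subr_eq0.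
have : \sum_v g u0 v = 0 by apply: big1 => v _; rewrite (g_const _ u0 _ u0).
have -> : \sum_v g u0 v = (k%:R - x) * (k%:R - y).
  rewrite !big_split /= sumrN -!big_distrr /= sum_delta -!natr_sum.
  by rewrite (sum_walks2 _ reg) reg; ring.
by move/eqP; rewrite mulf_eq0 [_ - y == 0]subr_eq0 (negPf ky) orbF.
Qed.

End Multigraph.

(** * The Hoffman-Singleton restriction on the degree *)

Section MooreGraph.

Variables (G : multigraph) (k : nat).
Hypothesis reg : regular G k.
Implicit Types u v w : vertex G.

Lemma moore_degree (x y : algC) :
    1 < k -> (forall u, mult u u = 0) -> order_of G = k ^ 2 + 1 ->
    x != y -> (x + y = -1)%R -> (x * y = 1 - k%:R)%R ->
    (forall u v, (walks2 u v)%:R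
       = (x + y) * (mult u v)%:R - x * y * (u == v)%:R + 1 :> algC)%R ->
  k \in [:: 2; 3; 7; 57].
Proof.
move=> k_gt1 loopless n_eq xy xDy xMy WE; have n_gt0 : 0 < order_of G by lia.
have nE : ((order_of G)%:R = k%:R ^+ 2 + 1 :> algC)%R by rewrite n_eq natrD natrX.
have := @mxtrace_three_eigenvalues _ _ (adjmx G) k%:R x y 1 n_gt0 xy.
case=> [||||f].
- apply/matrixP => i j; rewrite adjmx_sqr WE !mxE (inj_eq enum_val_inj).
  by ring.
- apply/matrixP => i j; rewrite !mxE mulr1 -(reg (enum_val i)) natr_sum.
  by rewrite sum_vertex_ord; apply: eq_bigr => l _; rewrite !mxE mulr1.
- apply/matrixP => i j; rewrite !mxE mulr1 -(reg (enum_val j)) natr_sum.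
  rewrite sum_vertex_ord; apply: eq_bigr => l _.
  by rewrite !mxE mul1r mult_sym.
- have -> : ((k%:R - x) * (k%:R - y) = k%:R ^+ 2 - (x + y) * k%:R + x * y)%R.
    by ring.
  by rewrite nE xDy xMy; ring.
have -> : (\tr (adjmx G) = 0)%R.
  by apply: big1 => i _; rewrite mxE loopless.
(* With [s = x - y], so that [s^2 = 4k - 3] and [y = -(1 + s)/2], the zero trace gives
   [(2f - k^2) s = k^2 - 2k]; squaring yields an integer equation. *)
rewrite nE => trE; apply: (@moore_arith k (2 * f%:Z - k%:Z ^+ 2)%R) => //.
apply: (@intr_inj algC); rewrite !(rmorphM, rmorphXn, rmorphB) /=.
rewrite -!pmulrn.
have yE : (y = -1 - x)%R by rewrite -xDy; ring.
have disc : ((x - y) ^+ 2 = 4 * k%:R - 3)%R.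
  have -> : ((x - y) ^+ 2 = (x + y) ^+ 2 - 4 * (x * y))%R by ring.
  by rewrite xDy xMy; ring.
rewrite -disc -exprMn; congr (_ ^+ 2)%R.
have -> : ((2 * f%:R - k%:R ^+ 2) * (x - y)
   = 2 * (f%:R * (x - y)) - k%:R ^+ 2 * (x - y))%R by ring.
by rewrite -trE yE; ring.
Qed.

End MooreGraph.

(** * The case [c = 1]: simplicity and absence of loops *)

Section UnitParameter.

Variables (G : multigraph) (k : nat).
Hypothesis reg : regular G k.
Implicit Types u v w : vertex G.

Variables x y : algC.
Hypothesis WE : forall u v, ((walks2 u v)%:R
  = (x + y) * (mult u v)%:R - x * y * (u == v)%:R + 1 :> algC)%R.

Lemma unit_walks2_neq u v :
  u != v -> ((walks2 u v)%:R = (x + y) * (mult u v)%:R + 1 :> algC)%R.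
Proof. by move=> uv; rewrite WE (negPf uv) mulr0 subr0. Qed.

Lemma unit_walks2_nonadjacent u v : u != v -> ~~ adjacent u v -> walks2 u v = 1.
Proof.
move=> uv nuv; apply/eqP; rewrite -(eqr_nat algC) (unit_walks2_neq uv).
have -> : mult u v = 0 by apply/eqP; rewrite -leqn0 leqNgt.
by rewrite mulr0 add0r.
Qed.

(* Past the bound every vertex misses some other vertex by 2-walks, so
   [x + y = -1/m] with [m] the multiplicity of an edge; then all edges have
   multiplicity [m], and [m ^ 2] divides the entry [1] of [A ^ 2] at a
   non-adjacent pair. *)
Lemma unit_parameter_simple u1 v1 :
    k ^ 2 - k + 1 < order_of G -> u1 != v1 -> ~~ adjacent u1 v1 ->
  [/\ forall u, mult u u = 0, forall u v, mult u v <= 1 & (x + y = -1)%R].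
Proof.
move=> n_gt uv1 nuv1.
have zero_walk u : exists2 v, adjacent u v & u != v /\ walks2 u v = 0.
  suff /existsP[v /andP[uv /eqP W0]] : [exists v, (u != v) && (walks2 u v == 0)].
    exists v => //; apply: contraPT W0 => nuv.
    by rewrite (unit_walks2_nonadjacent uv nuv).
  apply: contraTT n_gt; rewrite -leqNgt negb_exists => /forallP W_neq0.
  apply: (order_le_walks2 reg (u := u)) => v vu.
  by have := W_neq0 v; rewrite eq_sym vu lt0n.
(* A loop at [u] followed by an edge to [v] would be a 2-walk from [u] to [v]. *)
have loopless u : mult u u = 0.
  have [v uv [_ W0]] := zero_walk u; apply/eqP; rewrite -leqn0 leqNgt.
  by apply/negP => uu; have := walks2_gt0 uu uv; rewrite W0.
have [v2 uv2 [u1v2 W0]] := zero_walk u1; pose m := mult u1 v2.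
have m_gt0 : 0 < m by [].
have xm : ((x + y) * m%:R = -1 :> algC)%R.
  by have := unit_walks2_neq u1v2; rewrite W0 => /esym/eqP; rewrite addr_eq0 => /eqP.
(* Multiplying the 2-walk formula by [m] clears the denominator of [x + y]; over the naturals this
   leaves only 0 and [m] as multiplicities. *)
have mWE u v : u != v -> m * walks2 u v + mult u v = m.
  move=> uv; apply/eqP; rewrite -(eqr_nat algC) natrD natrM (unit_walks2_neq uv).
  by rewrite mulrDr mulr1 mulrA [(m%:R * _)%R]mulrC xm mulN1r addrC addrA addrN
    add0r.
have multE u v : adjacent u v -> mult u v = m.
  rewrite /adjacent; have [->|uv] := eqVneq u v; first by rewrite loopless.
  by have := mWE u v uv; case: (walks2 u v) => [|W]; nia.
have m1 : m = 1.
  have W1 := unit_walks2_nonadjacent uv1 nuv1.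
  have /existsP[w /andP[u1w wv1]] :
      [exists w, (0 < mult u1 w) && (0 < mult w v1)].
    apply: contraPT W1; rewrite negb_exists => /forallP noW.
    rewrite /walks2 big1 // => w _; have := noW w; rewrite negb_and -!eqn0Ngt.
    by case/orP => /eqP->; rewrite ?muln0.
  have : mult u1 w * mult w v1 <= 1 by rewrite -W1 /walks2 (bigD1 w) //= leq_addr.
  by rewrite (multE _ _ u1w) (multE _ _ wv1); nia.
split=> [//|u v|]; last by rewrite -xm m1 mulr1.
by have [->|/multE->] := posnP (mult u v); rewrite ?m1.
Qed.

End UnitParameter.

Theorem theorem3p5 (G : multigraph) (k n : nat)
  (hn : order_of G = n)
  (hconn : connected G)
  (hreg : regular G k)
  (heig : num_eigenvalues G 3)
  (hk2 : k <> 2) (hk3 : k <> 3) (hk7 : k <> 7) (hk57 : k <> 57) :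
  n <= k ^ 2 - k + 1.
Proof.
rewrite leqNgt; apply/negP => n_gt.
have n_ge3 : 3 <= n by rewrite -hn num_eigenvalues_leq_order.
have [x [y [c [xy c0 WE]]]] := walks2_three_eigenvalues hconn hreg heig.
have [n_gt0 _] := hconn.
pose u1 : vertex G := enum_val (Ordinal n_gt0).
(* Otherwise [n <= k + 1], which with the assumed lower bound forces [k = 1] and [n = 2], too few
   vertices for three eigenvalues. *)
have [v1 uv1 nuv1] : exists2 v1, u1 != v1 & ~~ adjacent u1 v1.
  suff /existsP[v /andP[]] : [exists v, (u1 != v) && ~~ adjacent u1 v] by exists v.
  apply: contraTT n_gt; rewrite negb_exists -leqNgt => /forallP adj.
  have : order_of G <= k + 1.
    apply: (order_le_complete hreg (u := u1)) => v vu.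
    by have := adj v; rewrite eq_sym vu negbK.
  by rewrite hn; nia.
have mult0 v : ~~ adjacent u1 v -> mult u1 v = 0.
  by rewrite /adjacent -leqNgt leqn0 => /eqP.
have cE v : u1 != v -> ~~ adjacent u1 v -> (c = (walks2 u1 v)%:R)%R.
  by move=> uv nuv; rewrite WE (mult0 _ nuv) (negPf uv) !mulr0 subr0 add0r.
have W_gt0 : 0 < walks2 u1 v1.
  by rewrite lt0n; apply: contra_neq c0 => W0; rewrite (cE v1) // W0.
have W1 : walks2 u1 v1 = 1.
  (* If [c >= 2], the two bounds on [n] give [(k - 1)(k - 2) <= 0]; [k = 1] would need [n <= 2], and
     [k = 2] is excluded. *)
  apply/eqP; rewrite eqn_leq W_gt0 andbT leqNgt; apply/negP => W_gt1.
  have : 2 * order_of G <= k ^ 2 + k + 2.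
    apply: (order_le_two_walks hreg (u := u1)) => v; rewrite eq_sym => uv nuv.
    suff -> : walks2 u1 v = walks2 u1 v1 by [].
    by apply/eqP; rewrite -(eqr_nat algC) -!cE.
  by rewrite hn; nia.
have c1 : c = 1%R by rewrite (cE v1) // W1.
rewrite {}c1 in WE.
have [|loopless mult_le1 xDy] := unit_parameter_simple hreg WE _ uv1 nuv1.
  by rewrite hn.
have Wdiag : walks2 u1 u1 = k.
  rewrite -(hreg u1); apply: eq_bigr => w _; rewrite (mult_sym w).
  by have := mult_le1 u1 w; case: (mult u1 w) => [|[]].
have xMy : (x * y = 1 - k%:R)%R.
  have := WE u1 u1; rewrite Wdiag loopless eqxx => ->; rewrite mulr0 mulr1; ring.
(* Summing the 2-walk formula over row [u1] gives [k^2 = -k - (1 - k) + n]. *)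
have nE : order_of G = k ^ 2 + 1.
  apply/eqP; rewrite -(eqr_nat algC) -(sum_walks2 u1 hreg) natrD natr_sum.
  under eq_bigr do rewrite WE.
  rewrite !big_split /= sumrN -!big_distrr /= -natr_sum hreg sumr_const sum_delta.
  by rewrite xDy xMy /order_of; apply/eqP; ring.
have k_gt1 : 1 < k by nia.
have := moore_degree hreg k_gt1 loopless nE xy xDy xMy WE.
by rewrite !inE => /or4P[] /eqP.
Qed.
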